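(* Let $\mathcal{C}\subseteq\mathbb{R}^n$ be nonempty, compact, convex and $\alpha$-strongly convex with $\alpha>0$, let $F:\mathcal{C}\to\mathbb{R}^n$ be monotone, $C^1$ and $\beta$-cocoercive with $\beta>0$, and let $\{x_k\}_{k\ge 0}$ be a sequence generated by the Frank-Wolfe iteration $$x_{k+1}=x_k+\gamma_{k+1}(s_k-x_k),\qquad s_k\in\operatorname{argmin}_{s\in\mathcal{C}}\langle F(x_k),s\rangle,\qquad x_0\in\mathcal{C},$$ with step sizes $\gamma_k\in(0,1]$ $(k\ge 1)$ satisfying $\gamma_k\to 0$ and $\sum_{k=1}^\infty\gamma_k=\infty$. Assume there exists $\bar\gamma>0$ such that $1-\gamma_{k+1}\ge\bar\gamma$ for all $k\ge 1$. Let $V(x)=\max_{s\in\mathcal{C}}\langle F(x),x-s\rangle$ for $x\in\mathcal{C}$. Then for all $k\ge 1$, $$V(x_{k+1})\le\max\big\{(1-\gamma_{k+1})V(x_k),\ B\gamma_{k+1}\big\},\qquad\text{where } B=\operatorname{diam}(\mathcal{C})\left(\frac{2}{\alpha\beta\bar\gamma}+\frac{\operatorname{diam}(\mathcal{C})}{\beta}\right).$$ In particular, if $\gamma_k=1/k$ for all $k\ge 1$, then one may take $\bar\gamma=\frac12$, and for all $k\ge 1$, $$V(x_k)\le\frac{A}{k},\qquad\text{where } A=\max\{V(x_1),B\}\text{ (with } B \text{ computed with } \bar\gamma=\tfrac12).$$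
   Context: $\|\cdot\|$ is the Euclidean norm and $\langle\cdot,\cdot\rangle$ the Euclidean inner product on $\mathbb{R}^n$; $\operatorname{diam}(\mathcal{C})=\max_{x,y\in\mathcal{C}}\|x-y\|$. $F$ is monotone if $\langle F(x)-F(y),x-y\rangle\ge 0$ for all $x,y\in\mathcal{C}$, and $\beta$-cocoercive if $\langle F(x)-F(y),x-y\rangle\ge\beta\|F(x)-F(y)\|^2$ for all $x,y\in\mathcal{C}$. A nonempty set $\mathcal{C}$ is $\alpha$-strongly convex if for all $x,y\in\mathcal{C}$ and $t\in[0,1]$ one has $B\big((1-t)x+ty,\tfrac{\alpha}{2}t(1-t)\|x-y\|^2\big)\subseteq\mathcal{C}$, where $B(c,r)$ is the closed Euclidean ball with center $c$ and radius $r$ (with $B(c,0)=\{c\}$). At each step $s_k$ is an arbitrary element of the argmin set (which may be non-singleton when $F(x_k)=0$). $V$ is called the Frank-Wolfe gap. The number $B$ in the claim is a constant, not a ball. *)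

(* Defs.v *)
From mathcomp Require Import all_boot all_order all_algebra.
From mathcomp Require Import all_classical all_reals all_analysis.

Set Implicit Arguments.
Unset Strict Implicit.
Unset Printing Implicit Defensive.

Import Order.TTheory GRing.Theory Num.Theory.
Import numFieldNormedType.Exports.

Local Open Scope classical_set_scope.
Local Open Scope ring_scope.

Definition dot (R : realType) (n : nat) (u v : 'rV[R]_n) : R :=
  \sum_(i < n) u 0 i * v 0 i.

(* The library norm `|u| on 'rV[R]_n is the sup norm; the two norms induce the
   same topology, but the metric notions below need the Euclidean one. *)
Definition enorm (R : realType) (n : nat) (u : 'rV[R]_n) : R :=
  Num.sqrt (dot u u).

Definition eball (R : realType) (n : nat) (c : 'rV[R]_n) (r : R) :
  set 'rV[R]_n := [set z | enorm (z - c) <= r].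

(* Greatest element of A; the junk value 0 is returned only when A has none. *)
Definition set_max (R : realType) (A : set R) : R :=
  xget 0 [set m | A m /\ ubound A m].

Definition diam (R : realType) (n : nat) (C : set 'rV[R]_n) : R :=
  set_max [set r | exists x y, [/\ C x, C y & r = enorm (x - y)]].

Definition strongly_convex (R : realType) (n : nat) (alpha : R)
    (C : set 'rV[R]_n) : Prop :=
  C !=set0 /\
  forall (x y : 'rV[R]_n) (t : R), C x -> C y -> 0 <= t <= 1 ->
    eball ((1 - t) *: x + t *: y)
          (alpha / 2 * t * (1 - t) * enorm (x - y) ^+ 2) `<=` C.

(* A map C -> R^n is encoded by a total F of which only the values on C are
   used. *)

Definition monotone_on (R : realType) (n : nat) (C : set 'rV[R]_n)
    (F : 'rV[R]_n -> 'rV[R]_n) : Prop :=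
  forall x y, C x -> C y -> 0 <= dot (F x - F y) (x - y).

Definition cocoercive_on (R : realType) (n : nat) (beta : R)
    (C : set 'rV[R]_n) (F : 'rV[R]_n -> 'rV[R]_n) : Prop :=
  forall x y, C x -> C y ->
    beta * enorm (F x - F y) ^+ 2 <= dot (F x - F y) (x - y).

(* C^1 relative to C, which need not be open: F is differentiable at every
   point of C along C, with a derivative continuous on C.  Every restriction to
   C of a C^1 map defined on an open neighbourhood of C is of this kind.  The
   matrix DF x acts on row vectors from the right. *)
Definition C1_on (R : realType) (n : nat) (C : set 'rV[R]_n)
    (F : 'rV[R]_n -> 'rV[R]_n) : Prop :=
  exists DF : 'rV[R]_n -> 'M[R]_n,
    {within C, continuous DF} /\
    forall x, C x -> forall e : R, 0 < e ->
      \forall y \near within C (nbhs x),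
        enorm (F y - F x - (y - x) *m DF x) <= e * enorm (y - x).

Definition argmin_on (R : realType) (T : Type) (C : set T) (f : T -> R) :
  set T := [set s | C s /\ forall t, C t -> f s <= f t].

(* gamma is used at indices k >= 1 only. *)
Definition step_sizes (R : realType) (gamma : nat -> R) : Prop :=
  [/\ forall k : nat, (1 <= k)%N -> 0 < gamma k <= 1,
      gamma k @[k --> \oo] --> 0 &
      \sum_(1 <= k < m) gamma k @[m --> \oo] --> +oo].

Definition frank_wolfe (R : realType) (n : nat) (C : set 'rV[R]_n)
    (F : 'rV[R]_n -> 'rV[R]_n) (gamma : nat -> R)
    (s x : nat -> 'rV[R]_n) : Prop :=
  C (x 0%N) /\
  forall k : nat,
    argmin_on C (fun t => dot (F (x k)) t) (s k) /\
    x k.+1 = x k + gamma k.+1 *: (s k - x k).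

Definition fw_gap (R : realType) (n : nat) (C : set 'rV[R]_n)
    (F : 'rV[R]_n -> 'rV[R]_n) (x : 'rV[R]_n) : R :=
  set_max [set dot (F x) (x - s) | s in C].

Definition gap_const (R : realType) (n : nat) (C : set 'rV[R]_n)
    (alpha beta gbar : R) : R :=
  diam C * (2 / (alpha * beta * gbar) + diam C / beta).

(* Main.v *)
Require Import Defs.
From mathcomp Require Import all_boot all_order all_algebra.
From mathcomp Require Import all_classical all_reals all_analysis.
From mathcomp Require Import ring lra.
Import Order.TTheory GRing.Theory Num.Theory.
Import numFieldNormedType.Exports.
Local Open Scope classical_set_scope.
Local Open Scope ring_scope.

(** Write y = x + g (s - x) for one step, where s minimizes <F x, .> and s'
    minimizes <F y, .> over C, and put delta = |F y - F x|, d = |s - s'|,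
    D = diam C.  Since y - s = (1 - g)(x - s),
      V(y) = <F y, y - s'>
           = (1 - g) V(x) - (1 - g) <F y - F x, s - x> + <F y, s - s'>.
    Cocoercivity along y - x = g (s - x) makes the middle term at most
    - (1 - g) beta delta^2 / g, and optimality of s for F x makes the last one
    at most <F y - F x, s - s'> <= delta d.  There are two cases.
    - If g d <= (1 - g) beta delta, the cocoercive decrease absorbs the change
      of minimizer and V(y) <= (1 - g) V(x).
    - Otherwise the minimizer moves far compared with the operator.  Strong
      convexity of C gives <F y, s - s'> >= (alpha / 2) d^2 |F y|
      (argmin_sconvex_growth), so (alpha / 2) d |F y| <= delta, and delta is
      less than g d / (gbar beta).  Hence |F y| <= 2 g / (alpha beta gbar),
      and V(y) <= D |F y| is at most the second term of the maximum.
    This is fw_gap_step.  For g = 1 / k.+1 both terms of the maximum are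
    bounded by A / k.+1 as soon as V(x_k) <= A / k, whence the O(1/k) rate. *)

(** * Euclidean inner product and norm *)

Lemma dotC {R : realType} {n : nat} (u v : 'rV[R]_n) : dot u v = dot v u.
Proof. by apply: eq_bigr => i _; rewrite mulrC. Qed.

Lemma dotDr {R : realType} {n : nat} (u v w : 'rV[R]_n) :
  dot u (v + w) = dot u v + dot u w.
Proof. by rewrite -big_split; apply: eq_bigr => i _; rewrite mxE mulrDr. Qed.

Lemma dotZr {R : realType} {n : nat} (u v : 'rV[R]_n) (a : R) :
  dot u (a *: v) = a * dot u v.
Proof. by rewrite mulr_sumr; apply: eq_bigr => i _; rewrite mxE mulrCA. Qed.

Lemma dotNr {R : realType} {n : nat} (u v : 'rV[R]_n) :
  dot u (- v) = - dot u v.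
Proof. by rewrite -scaleN1r dotZr mulN1r. Qed.

Lemma dotBr {R : realType} {n : nat} (u v w : 'rV[R]_n) :
  dot u (v - w) = dot u v - dot u w.
Proof. by rewrite dotDr dotNr. Qed.

Lemma dotBl {R : realType} {n : nat} (u v w : 'rV[R]_n) :
  dot (u - v) w = dot u w - dot v w.
Proof. by rewrite dotC dotBr ![dot w _]dotC. Qed.

Lemma dotZl {R : realType} {n : nat} (u v : 'rV[R]_n) (a : R) :
  dot (a *: u) v = a * dot u v.
Proof. by rewrite dotC dotZr dotC. Qed.

Lemma dot0l {R : realType} {n : nat} (u : 'rV[R]_n) : dot 0 u = 0.
Proof. by rewrite -(scale0r (0 : 'rV[R]_n)) dotZl mul0r. Qed.

Lemma dot_ge0 {R : realType} {n : nat} (u : 'rV[R]_n) : 0 <= dot u u.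
Proof. by apply: sumr_ge0 => i _; rewrite -expr2 sqr_ge0. Qed.

Lemma enorm_ge0 {R : realType} {n : nat} (u : 'rV[R]_n) : 0 <= enorm u.
Proof. exact: sqrtr_ge0. Qed.

Lemma sqr_enorm {R : realType} {n : nat} (u : 'rV[R]_n) :
  enorm u ^+ 2 = dot u u.
Proof. by rewrite sqr_sqrtr ?dot_ge0. Qed.

Lemma enormZ {R : realType} {n : nat} (a : R) (u : 'rV[R]_n) :
  enorm (a *: u) = `|a| * enorm u.
Proof.
by rewrite /enorm dotZl dotZr mulrA -expr2 sqrtrM ?sqr_ge0// sqrtr_sqr.
Qed.

Lemma enormN {R : realType} {n : nat} (u : 'rV[R]_n) : enorm (- u) = enorm u.
Proof. by rewrite -scaleN1r enormZ normrN1 mul1r. Qed.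

Lemma enorm0 {R : realType} {n : nat} : enorm (0 : 'rV[R]_n) = 0.
Proof. by rewrite -(scale0r 0) enormZ normr0 mul0r. Qed.

Lemma enorm_eq0 {R : realType} {n : nat} (u : 'rV[R]_n) :
  enorm u = 0 -> u = 0.
Proof.
move=> u0; have := sqr_enorm u; rewrite u0 expr0n => /esym/eqP.
rewrite psumr_eq0 => [/allP u_eq0|i _]; last by rewrite -expr2 sqr_ge0.
apply/rowP => i; rewrite mxE; apply/eqP.
by have := u_eq0 i; rewrite mem_index_enum mulf_eq0 orbb; exact.
Qed.

(** The square of |v| u - |u| v equals 2 |u| |v| (|u| |v| - <u, v>), which gives
    the inequality after division by |u| |v|. *)
Lemma cauchy_schwarz {R : realType} {n : nat} (u v : 'rV[R]_n) :
  dot u v <= enorm u * enorm v.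
Proof.
have [/enorm_eq0-> | u_neq0] := eqVneq (enorm u) 0.
  by rewrite enorm0 mul0r dot0l.
have [/enorm_eq0-> | v_neq0] := eqVneq (enorm v) 0.
  by rewrite enorm0 mulr0 dotC dot0l.
have u_gt0 : 0 < enorm u by rewrite lt_def u_neq0 enorm_ge0.
have v_gt0 : 0 < enorm v by rewrite lt_def v_neq0 enorm_ge0.
have := dot_ge0 (enorm v *: u - enorm u *: v).
rewrite dotBl !dotBr !dotZl !dotZr (dotC v u) -!sqr_enorm.
set a := enorm u in u_gt0 *; set b := enorm v in v_gt0 *; set c := dot u v.
have -> : b * (b * a ^+ 2) - b * (a * c) - (a * (b * c) - a * (a * b ^+ 2)) =
    2 * (a * b) * (a * b - c) by ring.
by rewrite pmulr_rge0 ?subr_ge0// !mulr_gt0.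
Qed.

(** * Attained maxima: diameter and Frank-Wolfe gap *)

Lemma set_maxE {R : realType} (A : set R) (m : R) :
  A m -> ubound A m -> set_max A = m.
Proof.
move=> Am mA.
have [AM MA] : [set M | A M /\ ubound A M] (set_max A).
  by apply: (@xgetPex _ 0 [set M | A M /\ ubound A M]); exists m.
by apply/eqP; rewrite eq_le mA ?MA.
Qed.

(** The supremum defining the diameter is attained because C x C is compact and
    the Euclidean distance is continuous for the product topology of the
    coordinates; so diam C is not the default value. *)
Lemma enorm_le_diam {R : realType} {n : nat} {C : set 'rV[R]_n}
    {x y : 'rV[R]_n} :
  compact C -> C x -> C y -> enorm (x - y) <= diam C.
Proof.
move=> cC Cx Cy.
have cont : continuous (fun p : 'rV[R]_n * 'rV[R]_n => enorm (p.1 - p.2)).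
  move=> p; apply: (@continuous_comp _ _ _
    (fun q : 'rV[R]_n * 'rV[R]_n => dot (q.1 - q.2) (q.1 - q.2)) Num.sqrt);
    last exact: sqrt_continuous.
  apply: cvg_big => [|i _]; first exact: add_continuous.
  have coord : (fun q : 'rV[R]_n * 'rV[R]_n => (q.1 - q.2) 0 i) @ p -->
               (p.1 - p.2) 0 i.
    apply: (@continuous_comp _ _ _ (fun q : 'rV[R]_n * 'rV[R]_n => q.1 - q.2)
      (fun M : 'rV[R]_n => M 0 i)); last exact: coord_continuous.
    by apply: cvgB; [exact: cvg_fst|exact: cvg_snd].
  exact: cvgM.
have CC0 : C `*` C !=set0 by exists (x, y).
have [[a b]] :=
  compact_EVT_max CC0 (compact_setX cC cC) (continuous_subspaceT cont).
rewrite inE => -[/= Ca Cb] max_ab.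
rewrite /diam (@set_maxE _ _ (enorm (a - b))).
- by apply: (max_ab (x, y)); rewrite inE.
- by exists a, b.
- by move=> _ [u [v [Cu Cv ->]]]; apply: (max_ab (u, v)); rewrite inE.
Qed.

(** Any point returned by the linear minimization oracle attains the maximum
    that defines the gap, so the gap does not depend on the chosen
    minimizer. *)
Lemma fw_gapE {R : realType} {n : nat} {C : set 'rV[R]_n}
    {F : 'rV[R]_n -> 'rV[R]_n} {x s : 'rV[R]_n} :
  argmin_on C (fun t => dot (F x) t) s -> fw_gap C F x = dot (F x) (x - s).
Proof.
case=> Cs min_s; apply: set_maxE; first by exists s.
by move=> _ [t Ct <-]; rewrite !dotBr lerB// min_s.
Qed.

(** * Linear minimization over a strongly convex set *)

(** The point of [s, z] at parameter t can be pushed in the direction - g / |g|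
    by the radius r of the ball granted by strong convexity without leaving C.
    Minimality of s then yields t <g, z - s> >= r |g|, where r is proportional
    to t (1 - t).  Dividing by t and letting t tend to 0 gives the constant
    alpha / 2. *)
Lemma argmin_sconvex_growth {R : realType} {n : nat} {alpha : R}
    {C : set 'rV[R]_n} {g s z : 'rV[R]_n} :
  0 < alpha -> strongly_convex alpha C -> argmin_on C (fun t => dot g t) s ->
  C z ->
  alpha / 2 * enorm (z - s) ^+ 2 * enorm g <= dot g (z - s).
Proof.
move=> alpha_gt0 [_ sconv] [Cs min_s] Cz.
have [/enorm_eq0 -> | g_neq0] := eqVneq (enorm g) 0.
  by rewrite enorm0 mulr0 dot0l.
set q := alpha / 2 * enorm (z - s) ^+ 2 * enorm g.
have q_ge0 : 0 <= q by rewrite !mulr_ge0 ?invr_ge0 ?exprn_ge0 ?enorm_ge0// ltW.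
have growth (t : R) : 0 < t -> t <= 1 -> (1 - t) * q <= dot g (z - s).
  move=> t_gt0 t_le1.
  pose r := alpha / 2 * t * (1 - t) * enorm (s - z) ^+ 2.
  have r_ge0 : 0 <= r.
    by rewrite !mulr_ge0 ?invr_ge0 ?exprn_ge0 ?enorm_ge0 ?subr_ge0// ltW.
  have Cw : C ((1 - t) *: s + t *: z - (r / enorm g) *: g).
    apply: (sconv s z t) => //; first by rewrite ltW.
    rewrite /eball/= addrAC subrr add0r enormN enormZ.
    by rewrite ger0_norm ?divr_ge0 ?enorm_ge0// divfK.
  have := min_s _ Cw.
  have -> : dot g ((1 - t) *: s + t *: z - (r / enorm g) *: g) =
      dot g s + t * dot g (z - s) - t * ((1 - t) * q).
    rewrite !dotBr dotDr !dotZr -sqr_enorm expr2 mulrA divfK//.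
    by rewrite /r -(enormN (s - z)) opprB /q; ring.
  by move=> le_s; rewrite -(ler_pM2l t_gt0); lra.
clearbody q; rewrite leNgt; apply/negP => lt_q.
have dot_ge : 0 <= dot g (z - s).
  by have := growth 1 ltr01 (lexx 1); rewrite subrr mul0r.
have q_gt0 : 0 < q := le_lt_trans dot_ge lt_q.
(* At this t, (1 - t) * q is the midpoint of q and dot g (z - s), so the bound
   for t contradicts lt_q. *)
pose t := (q - dot g (z - s)) / (2 * q).
have t_gt0 : 0 < t by rewrite divr_gt0 ?subr_gt0// mulr_gt0.
have t_le1 : t <= 1 by rewrite ler_pdivrMr ?mulr_gt0//; lra.
have := growth t t_gt0 t_le1.
have -> : (1 - t) * q = (q + dot g (z - s)) / 2.
  by rewrite /t; field; rewrite gt_eqF.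
lra.
Qed.

(** * One Frank-Wolfe step *)

(** The centre of the ball in the definition of strong convexity is the new
    iterate. *)
Lemma fw_step_in {R : realType} {n : nat} {alpha : R} {C : set 'rV[R]_n}
    {x s : 'rV[R]_n} {g : R} :
  0 < alpha -> strongly_convex alpha C -> C x -> C s -> 0 <= g <= 1 ->
  C (x + g *: (s - x)).
Proof.
move=> alpha_gt0 [_ sconv] Cx Cs /andP[g_ge0 g_le1].
apply: (sconv x s g) => //; first by rewrite g_ge0.
rewrite /eball/=.
have -> : x + g *: (s - x) - ((1 - g) *: x + g *: s) = 0.
  by apply/rowP => i; rewrite !mxE; ring.
by rewrite enorm0 !mulr_ge0 ?invr_ge0 ?exprn_ge0 ?enorm_ge0 ?subr_ge0// ltW.
Qed.

(** The comparison of g d with (1 - g) beta delta decides which term of the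
    maximum bounds the new gap: contraction when the minimizer moves little,
    smallness of |F y| when it moves much. *)
Lemma fw_gap_step {R : realType} {n : nat} {C : set 'rV[R]_n}
    {alpha beta gbar g : R} {F : 'rV[R]_n -> 'rV[R]_n} {x s s' : 'rV[R]_n} :
  let y := x + g *: (s - x) in
  compact C -> 0 < alpha -> strongly_convex alpha C ->
  0 < beta -> cocoercive_on beta C F ->
  0 < g <= 1 -> 0 < gbar -> gbar <= 1 - g ->
  C x -> argmin_on C (fun t => dot (F x) t) s ->
  argmin_on C (fun t => dot (F y) t) s' ->
  fw_gap C F y <=
    Num.max ((1 - g) * fw_gap C F x) (gap_const C alpha beta gbar * g).
Proof.
move=> y cC alpha_gt0 sconv beta_gt0 coco /andP[g_gt0 g_le1] gbar_gt0 gbar_le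
  Cx min_s min_s'.
have [Cs le_s] := min_s; have [Cs' le_s'] := min_s'.
have Cy : C y by apply: (fw_step_in alpha_gt0 sconv) => //; rewrite ltW.
rewrite (fw_gapE min_s) (fw_gapE min_s').
pose delta := enorm (F y - F x); pose d := enorm (s - s').
have delta_ge0 : 0 <= delta := enorm_ge0 _.
have d_ge0 : 0 <= d := enorm_ge0 _.
have G_ge0 : 0 <= enorm (F y) := enorm_ge0 _.
have D_ge0 : 0 <= diam C.
  exact: le_trans (enorm_ge0 _) (enorm_le_diam cC Cs Cs').
have coco_xy : beta * delta ^+ 2 <= g * dot (F y - F x) (s - x).
  have yBx : y - x = g *: (s - x) by rewrite addrAC subrr add0r.
  by rewrite -dotZr -yBx; exact: coco.
have lmo_le : dot (F y) (s - s') <= delta * d.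
  apply: le_trans (cauchy_schwarz _ _); rewrite !dotBl !dotBr.
  by have := le_s _ Cs'; lra.
have growth : alpha / 2 * d ^+ 2 * enorm (F y) <= dot (F y) (s - s').
  exact: (argmin_sconvex_growth alpha_gt0 sconv min_s' Cs).
have gapE : dot (F y) (y - s') =
    (1 - g) * dot (F x) (x - s) - (1 - g) * dot (F y - F x) (s - x) +
    dot (F y) (s - s').
  by rewrite /y !dotBl !dotBr dotDr dotZr dotBr; ring.
have gap_le : dot (F y) (y - s') <= enorm (F y) * diam C.
  apply: le_trans (cauchy_schwarz _ _) _.
  by rewrite ler_wpM2l// (enorm_le_diam cC).
rewrite le_max; apply/orP.
have [small_d | large_d] := leP (g * d) ((1 - g) * beta * delta); [left|right].
  (* After multiplication by g the excess over the contraction is at most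
     delta * (g * d - (1 - g) * beta * delta). *)
  rewrite -(ler_pM2l g_gt0) gapE; nra.
have d_gt0 : 0 < d.
  rewrite -(pmulr_rgt0 _ g_gt0); apply: le_lt_trans large_d.
  by rewrite !mulr_ge0 ?subr_ge0// ltW.
have Fy_le : alpha / 2 * d * enorm (F y) <= delta.
  rewrite -(ler_pM2r d_gt0); apply: le_trans (le_trans growth lmo_le).
  by rewrite -/d; lra.
have Fy_le' : enorm (F y) <= 2 / (alpha * beta * gbar) * g.
  rewrite mulrAC ler_pdivlMr ?mulr_gt0//.
  have bd_ge0 : 0 <= beta * delta by rewrite mulr_ge0// ltW.
  have := ler_wpM2r bd_ge0 gbar_le.
  have := ler_wpM2r (ltW (mulr_gt0 beta_gt0 gbar_gt0)) Fy_le.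
  by move=> ? ?; rewrite -(ler_pM2r d_gt0); lra.
rewrite /gap_const; apply: le_trans gap_le _.
rewrite mulrC -mulrA ler_wpM2l// mulrDl.
by rewrite (le_trans Fy_le')// lerDl !mulr_ge0 ?invr_ge0// ltW.
Qed.

Theorem theorem14 (R : realType) (n : nat) (C : set 'rV[R]_n) (alpha beta : R)
    (F : 'rV[R]_n -> 'rV[R]_n) (gamma : nat -> R) (s x : nat -> 'rV[R]_n)
    (C_nonempty : C !=set0)
    (C_compact : compact C)
    (C_convex : @convex_set R 'rV[R]_n C)
    (alpha_gt0 : 0 < alpha)
    (C_sconvex : strongly_convex alpha C)
    (F_monotone : monotone_on C F)
    (F_C1 : C1_on C F)
    (beta_gt0 : 0 < beta)
    (F_cocoercive : cocoercive_on beta C F)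
    (gamma_steps : step_sizes gamma)
    (x_FW : frank_wolfe C F gamma s x) :
  (forall gbar : R, 0 < gbar ->
     (forall k : nat, (1 <= k)%N -> gbar <= 1 - gamma k.+1) ->
     forall k : nat, (1 <= k)%N ->
       fw_gap C F (x k.+1) <=
         Num.max ((1 - gamma k.+1) * fw_gap C F (x k))
                 (gap_const C alpha beta gbar * gamma k.+1)) /\
  ((forall k : nat, (1 <= k)%N -> gamma k = 1 / k%:R) ->
     (forall k : nat, (1 <= k)%N -> 1 / 2 <= 1 - gamma k.+1) /\
     forall k : nat, (1 <= k)%N ->
       fw_gap C F (x k) <=
         Num.max (fw_gap C F (x 1%N)) (gap_const C alpha beta (1 / 2)) / k%:R).
Proof.
have [gamma01 _ _] := gamma_steps; have [Cx0 FW] := x_FW.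
have Cx k : C (x k).
  elim: k => // k Cxk; have [[Csk _] ->] := FW k.
  have /andP[gk_gt0 gk_le1] := gamma01 k.+1 isT.
  by apply: (fw_step_in alpha_gt0 C_sconvex) => //; rewrite ltW.
have step gbar : 0 < gbar ->
    (forall k : nat, (1 <= k)%N -> gbar <= 1 - gamma k.+1) ->
    forall k : nat, (1 <= k)%N ->
    fw_gap C F (x k.+1) <= Num.max ((1 - gamma k.+1) * fw_gap C F (x k))
                                   (gap_const C alpha beta gbar * gamma k.+1).
  move=> gbar_gt0 gbar_le k k_ge1.
  have [min_sk xS] := FW k; have [min_sSk _] := FW k.+1.
  rewrite xS in min_sSk *.
  exact: (fw_gap_step C_compact alpha_gt0 C_sconvex beta_gt0 F_cocoercive
            (gamma01 _ _) gbar_gt0 (gbar_le _ _) (Cx k) min_sk min_sSk).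
split=> // gammaE.
have gbar_half k : (1 <= k)%N -> 1 / 2 <= 1 - gamma k.+1.
  move=> k_ge1; rewrite gammaE// lerBrDr -lerBrDl.
  have -> : 1 - 1 / 2 = 1 / 2 :> R by field.
  by rewrite !div1r lef_pV2 ?posrE ?ltr0n// ler_nat.
split=> //; set A := Num.max _ _.
elim=> // -[_ _|k IHk _]; first by rewrite divr1 le_max lexx.
apply: le_trans (step (1 / 2) _ gbar_half k.+1 isT) _; first by lra.
rewrite gammaE// ge_max; apply/andP; split.
  have -> : A / k.+2%:R = (1 - 1 / k.+2%:R) * (A / k.+1%:R).
    have k1_gt0 : 0 < k.+1%:R :> R by rewrite ltr0n.
    rewrite -[k.+2%:R]natr1; move: (k.+1%:R) k1_gt0 => m m_gt0.
    by field; rewrite !gt_eqF ?addr_gt0.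
  by rewrite ler_wpM2l ?IHk// subr_ge0 div1r invf_le1 ?ler1n ?ltr0n.
by rewrite (div1r k.+2%:R) ler_wpM2r ?invr_ge0 ?ler0n// le_max lexx orbT.
Qed.
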